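(* Let $X,Y\in\mathbb{R}^{n\times k}$ with $Y_{i,j}\sim\mathcal{N}(X_{i,j},\sigma^2)$ independent along each column. For $\Theta\in\mathbb{R}^{n\times n}$ and $\beta\in\mathbb{R}^n$ let $$\operatorname{SURE}_{\Theta,\beta}(Y)=\|\Theta Y-Y+\beta\mathbf{1}_k^\top\|_F^2+2k\sigma^2\operatorname{tr}(\Theta)-nk\sigma^2 .$$ Then $$\mathop{\arg\min}_{\Theta,\beta}\operatorname{SURE}_{\Theta,\beta}(Y)=\hat\Theta,\hat\beta$$ with $$\hat\Theta=(C_Y-\sigma^2I_n)C_Y^{-1},\qquad \hat\beta=(I_n-\hat\Theta)\mu_Y .$$
   Context: $\|\cdot\|_F$ is the Frobenius norm, $\mathbf{1}_k$ the all-ones vector in $\mathbb{R}^k$, $I_n$ the $n\times n$ identity matrix, and $\sigma>0$. For a group of patches $Z\in\mathbb{R}^{n\times k}$, the empirical mean and covariance matrix are $\mu_Z=\frac1k Z\mathbf{1}_k\in\mathbb{R}^n$ and $C_Z=\frac1k(Z-\mu_Z\mathbf{1}_k^\top)(Z-\mu_Z\mathbf{1}_k^\top)^\top\in\mathbb{R}^{n\times n}$. The minimization is over $\Theta\in\mathbb{R}^{n\times n}$ and $\beta\in\mathbb{R}^n$. $\operatorname{SURE}_{\Theta,\beta}(Y)$ is Stein's unbiased estimate of the quadratic risk $\mathbb{E}\|f_{\Theta,\beta}(Y)-X\|_F^2$ of the denoiser $f_{\Theta,\beta}(Y)=\Theta Y+\beta\mathbf{1}_k^\top$. *)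

(* Defs.v *)
From HB Require Import structures.
From mathcomp Require Import all_boot all_order all_algebra.
From mathcomp Require Import all_classical all_reals all_analysis.

Set Implicit Arguments.
Unset Strict Implicit.
Unset Printing Implicit Defensive.

Import Order.TTheory GRing.Theory Num.Theory.
Import numFieldNormedType.Exports.

Local Open Scope classical_set_scope.
Local Open Scope ring_scope.

(* The norm that MathComp-Analysis puts on matrices is the sup norm. *)
Definition frobenius_norm (R : realType) (m p : nat) (A : 'M[R]_(m, p)) : R :=
  Num.sqrt (\sum_i \sum_j A i j ^+ 2).

Definition ones (R : realType) (k : nat) : 'cV[R]_k := const_mx 1.

Definition emp_mean (R : realType) (n k : nat) (Z : 'M[R]_(n, k)) : 'cV[R]_n :=
  k%:R^-1 *: (Z *m ones R k).

Definition emp_cov (R : realType) (n k : nat) (Z : 'M[R]_(n, k)) : 'M[R]_n :=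
  let Zc := Z - emp_mean Z *m (ones R k)^T in
  k%:R^-1 *: (Zc *m Zc^T).

Definition SURE (R : realType) (n k : nat) (sigma : R) (Y : 'M[R]_(n, k))
    (Theta : 'M[R]_n) (beta : 'cV[R]_n) : R :=
  frobenius_norm (Theta *m Y - Y + beta *m (ones R k)^T) ^+ 2
  + 2 * k%:R * sigma ^+ 2 * \tr Theta - n%:R * k%:R * sigma ^+ 2.

(* Meaningful only when emp_cov Y is invertible; invmx is the identity map
   on singular matrices. *)
Definition Theta_hat (R : realType) (n k : nat) (sigma : R)
    (Y : 'M[R]_(n, k)) : 'M[R]_n :=
  (emp_cov Y - sigma ^+ 2 *: 1%:M) *m invmx (emp_cov Y).

Definition beta_hat (R : realType) (n k : nat) (sigma : R)
    (Y : 'M[R]_(n, k)) : 'cV[R]_n :=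
  (1%:M - Theta_hat sigma Y) *m emp_mean Y.

Definition argmin (R : realType) (T : Type) (f : T -> R) : set T :=
  [set x | forall y, f x <= f y].

Definition mutually_independent (d : measure_display) (T : measurableType d)
    (R : realType) (P : probability T R) (I : finType)
    (V : I -> {RV P >-> R}) : Prop :=
  forall (J : {set I}) (B : I -> set R),
    (forall i, i \in J -> measurable (B i)) ->
    P (\bigcap_(i in [set` J]) V i @^-1` B i)
      = (\prod_(i in J) P (V i @^-1` B i))%E.

(* N(m, sigma^2): the second parameter of normal_prob is the standard deviation. *)
Definition normally_distributed (d : measure_display) (T : measurableType d)
    (R : realType) (P : probability T R) (V : {RV P >-> R})
    (m sigma : R) : Prop :=
  forall B : set R, measurable B -> distribution P V B = normal_prob m sigma B.

Definition sample_mx (d : measure_display) (T : measurableType d)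
    (R : realType) (P : probability T R) (n k : nat)
    (Y : 'I_n -> 'I_k -> {RV P >-> R}) (w : T) : 'M[R]_(n, k) :=
  \matrix_(i, j) Y i j w.

(* Main.v *)
(* Centering Y splits the residual into orthogonal parts,
   Theta Y - Y + beta 1^T = (Theta - I) W + gamma 1^T with W = Y - mu 1^T,
   W 1 = 0 and gamma = beta - (I - Theta) mu.  Since W W^T = k C_Y, completing
   the square in Theta around the solution of (Theta - I) C_Y = - sigma^2 I gives
   SURE(Theta, beta) = SURE(hat) + |(Theta - Theta_hat) W|^2 + k |gamma|^2,
   and W has full row rank because C_Y is invertible. *)
Require Import Defs.
From HB Require Import structures.
From mathcomp Require Import all_boot all_order all_algebra.
From mathcomp Require Import all_classical all_reals all_analysis.
From mathcomp Require Import ring.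
Set Implicit Arguments.
Unset Strict Implicit.
Unset Printing Implicit Defensive.
Import Order.TTheory GRing.Theory Num.Theory.
Import numFieldNormedType.Exports.
Local Open Scope classical_set_scope.
Local Open Scope ring_scope.

Section Frobenius.
Variable R : realType.

Lemma sqr_frobenius_norm (m p : nat) (A : 'M[R]_(m, p)) :
  frobenius_norm A ^+ 2 = \sum_i \sum_j A i j ^+ 2.
Proof.
rewrite /frobenius_norm sqr_sqrtr //.
by apply: sumr_ge0 => i _; apply: sumr_ge0 => j _; exact: sqr_ge0.
Qed.

Lemma sqr_frobenius_norm_tr (m p : nat) (A : 'M[R]_(m, p)) :
  frobenius_norm A ^+ 2 = \tr (A *m A^T).
Proof.
rewrite sqr_frobenius_norm /mxtrace; apply: eq_bigr => i _.
by rewrite !mxE; apply: eq_bigr => j _; rewrite mxE expr2.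
Qed.

Lemma sqr_frobenius_norm_eq0 (m p : nat) (A : 'M[R]_(m, p)) :
  frobenius_norm A ^+ 2 = 0 -> A = 0.
Proof.
rewrite sqr_frobenius_norm => A0; apply/matrixP => i j; rewrite mxE.
have row0 : \sum_j A i j ^+ 2 = 0.
  apply: (psumr_eq0P _ A0) => // l _.
  by apply: sumr_ge0 => ? _; exact: sqr_ge0.
apply/eqP; rewrite -sqrf_eq0; apply/eqP.
by apply: (psumr_eq0P _ row0) => // l _; exact: sqr_ge0.
Qed.

Lemma sqr_frobenius_normD (m p : nat) (A B : 'M[R]_(m, p)) :
  frobenius_norm (A + B) ^+ 2 =
  frobenius_norm A ^+ 2 + 2 * \tr (A *m B^T) + frobenius_norm B ^+ 2.
Proof.
have BA : \tr (B *m A^T) = \tr (A *m B^T).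
  by rewrite -mxtrace_tr trmx_mul trmxK.
rewrite !sqr_frobenius_norm_tr linearD /= mulmxDl !mulmxDr !linearD /= BA.
by ring.
Qed.

End Frobenius.

Section Sure.
Variables (R : realType) (n k : nat).
Implicit Types (Y : 'M[R]_(n, k)) (Theta : 'M[R]_n) (beta : 'cV[R]_n).

Definition centered Y : 'M[R]_(n, k) := Y - emp_mean Y *m (ones R k)^T.

(** The deviation of [beta] from [(1%:M - Theta) *m emp_mean Y], the intercept that is best for this
    [Theta]. *)
Definition offset Y Theta beta : 'cV[R]_n :=
  beta - (1%:M - Theta) *m emp_mean Y.

Lemma tr_ones_mul_ones : (ones R k)^T *m ones R k = k%:R%:M.
Proof.
apply/matrixP => i j; rewrite !ord1 !mxE /=.
under eq_bigr do rewrite !mxE mulr1.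
by rewrite sumr_const card_ord mulr1n.
Qed.

(** With the denominator cleared the identity survives [k = 0]: a matrix without columns is zero, so
    both sides vanish. The same holds for [scale_emp_cov]. *)
Lemma scale_emp_mean Y : k%:R *: emp_mean Y = Y *m ones R k.
Proof.
rewrite /emp_mean scalerA; have [k0|k0] := eqVneq k 0%N.
  by move: (Y); rewrite k0 => Z; rewrite (thinmx0 Z) mul0mx scaler0.
by rewrite divff ?pnatr_eq0// scale1r.
Qed.

Lemma scale_emp_cov Y :
  k%:R *: emp_cov Y = centered Y *m (centered Y)^T.
Proof.
rewrite /emp_cov -/(centered Y) scalerA; have [k0|k0] := eqVneq k 0%N.
  move: (centered Y); rewrite k0 => Z.
  by rewrite (thinmx0 Z) mul0mx scaler0.
by rewrite divff ?pnatr_eq0// scale1r.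
Qed.

Lemma centered_ones Y : centered Y *m ones R k = 0.
Proof.
rewrite /centered mulmxBl -mulmxA tr_ones_mul_ones mul_mx_scalar scale_emp_mean.
exact: subrr.
Qed.

Lemma residualE Y Theta beta :
  Theta *m Y - Y + beta *m (ones R k)^T =
  (Theta - 1%:M) *m centered Y + offset Y Theta beta *m (ones R k)^T.
Proof.
rewrite /centered /offset mulmxBr [(beta - _) *m _]mulmxBl -mulmxA.
(* The identity holds for arbitrary matrices in place of these two products; generalizing them keeps
   [mxE] from expanding them into sums. *)
move: (emp_mean Y *m _) (beta *m _) => M B.
rewrite !mulmxBl !mul1mx; apply/matrixP => i j; rewrite !mxE.
by ring.
Qed.

Lemma SURE_centered sigma Y Theta beta :
  SURE sigma Y Theta beta =
  frobenius_norm ((Theta - 1%:M) *m centered Y) ^+ 2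
  + k%:R * frobenius_norm (offset Y Theta beta) ^+ 2
  + 2 * k%:R * sigma ^+ 2 * \tr Theta - n%:R * k%:R * sigma ^+ 2.
Proof.
rewrite /SURE residualE sqr_frobenius_normD.
(* The cross term contains the factor [centered Y *m ones R k], which is zero. *)
rewrite trmx_mul trmxK mulmxA -[_ *m centered Y *m _]mulmxA centered_ones.
rewrite mulmx0 mul0mx mxtrace0 mulr0 addr0.
(* The remaining square has the form |g 1^T|^2 = tr(g 1^T 1 g^T), and 1^T 1 = k gives the factor
   [k%:R]. *)
rewrite [X in _ + X + _ - _]sqr_frobenius_norm_tr trmx_mul trmxK mulmxA.
rewrite -[_ *m _ *m ones R k]mulmxA tr_ones_mul_ones mul_mx_scalar.
by rewrite -scalemxAl mxtraceZ -sqr_frobenius_norm_tr.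
Qed.

Lemma offset_hat sigma Y :
  offset Y (Theta_hat sigma Y) (beta_hat sigma Y) = 0.
Proof. exact: subrr. Qed.

(** This is the normal equation: up to a factor 2k, the gradient in [Theta] of the centered form of
    [SURE] vanishes at [Theta_hat]. *)
Lemma Theta_hat_sub1 sigma Y : emp_cov Y \in unitmx ->
  (Theta_hat sigma Y - 1%:M) *m emp_cov Y = - (sigma ^+ 2)%:M.
Proof.
move=> Cu; rewrite mulmxBl mulmxKV// mul1mx scalemx1.
by rewrite addrAC subrr add0r.
Qed.

Lemma SURE_hat_excess sigma Y Theta beta : emp_cov Y \in unitmx ->
  SURE sigma Y Theta beta =
  SURE sigma Y (Theta_hat sigma Y) (beta_hat sigma Y)
  + frobenius_norm ((Theta - Theta_hat sigma Y) *m centered Y) ^+ 2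
  + k%:R * frobenius_norm (offset Y Theta beta) ^+ 2.
Proof.
move=> Cu; rewrite !SURE_centered offset_hat.
set H := Theta_hat sigma Y; set D := Theta - H.
have -> : Theta - 1%:M = (H - 1%:M) + D by rewrite /D [RHS]addrC subrKA.
have -> : \tr Theta = \tr H + \tr D by rewrite -linearD /= /D [H + _]addrC subrK.
rewrite mulmxDl sqr_frobenius_normD.
(* By the normal equation, twice this cross term cancels the increment 2 k sigma^2 tr D of the trace
   penalty, so no term linear in [D] is left. *)
have -> : \tr ((H - 1%:M) *m centered Y *m (D *m centered Y)^T)
          = - (k%:R * sigma ^+ 2 * \tr D).
  rewrite trmx_mul mulmxA -[_ *m centered Y *m _]mulmxA -scale_emp_cov.
  rewrite -scalemxAr Theta_hat_sub1// -scalemxAl mulNmx mul_scalar_mx.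
  by rewrite mxtraceZ linearN /= mxtraceZ mxtrace_tr; ring.
by rewrite (sqr_frobenius_norm_tr 0) mul0mx mxtrace0; ring.
Qed.

Lemma argmin_SURE sigma Y : emp_cov Y \in unitmx ->
  argmin (fun p : 'M[R]_n * 'cV[R]_n => SURE sigma Y p.1 p.2)
  = [set (Theta_hat sigma Y, beta_hat sigma Y)].
Proof.
move=> Cu.
have offset_ge0 Theta beta :
    0 <= k%:R * frobenius_norm (offset Y Theta beta) ^+ 2.
  by apply: mulr_ge0; [exact: ler0n | exact: sqr_ge0].
apply/seteqP; split => [[ Theta beta] | _ ->] /=; last first.
  move=> [ Theta beta] /=; rewrite (SURE_hat_excess _ Theta beta Cu) -addrA.
  by rewrite lerDl addr_ge0 ?sqr_ge0 ?offset_ge0.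
move=> /(_ (Theta_hat sigma Y, beta_hat sigma Y)) /=.
rewrite (SURE_hat_excess _ Theta beta Cu) -addrA gerDl => excess_le0.
(* A minimizer has excess at most 0 over the hat pair; both parts of the excess are nonnegative, so
   each is zero. *)
have : frobenius_norm ((Theta - Theta_hat sigma Y) *m centered Y) ^+ 2
       + k%:R * frobenius_norm (offset Y Theta beta) ^+ 2 == 0.
  by rewrite eq_le excess_le0 addr_ge0 ?sqr_ge0 ?offset_ge0.
rewrite paddr_eq0 ?sqr_ge0 ?offset_ge0// [k%:R * _ == 0]mulf_eq0.
case/andP => /eqP/sqr_frobenius_norm_eq0 DW0 k0_or_offset0.
(* Multiplying by the transpose of [centered Y] turns the rank argument into cancellation of the
   invertible [emp_cov Y]. *)
have DC0 : (Theta - Theta_hat sigma Y) *m emp_cov Y = 0.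
  by rewrite /emp_cov -/(centered Y) -scalemxAr mulmxA DW0 mul0mx scaler0.
have ThetaE : Theta = Theta_hat sigma Y.
  by apply/eqP; rewrite -subr_eq0 -(mulmxK Cu (_ - _)) DC0 mul0mx.
have offset0 : offset Y Theta beta = 0.
  case/orP: k0_or_offset0 => [/eqP k0|/eqP/sqr_frobenius_norm_eq0//].
  (* For k = 0 the covariance is the zero matrix, which is only invertible
     when n = 0. *)
  rewrite -(mulKmx Cu (offset _ _ _)) {2}/emp_cov k0.
  by rewrite invr0 scale0r mul0mx mulmx0.
by rewrite ThetaE in offset0 *; rewrite (subr0_eq offset0).
Qed.

End Sure.

Theorem proposition9 (R : realType) (d : measure_display)
    (T : measurableType d) (P : probability T R) (n k : nat) (sigma : R)
    (X : 'M[R]_(n, k)) (Y : 'I_n -> 'I_k -> {RV P >-> R})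
    (sigma_gt0 : 0 < sigma)
    (Ynormal : forall i j, normally_distributed (Y i j) (X i j) sigma)
    (Yindep : forall j, mutually_independent (fun i => Y i j))
    (w : T) (covY_unit : emp_cov (sample_mx Y w) \in unitmx) :
  argmin (fun p : 'M[R]_n * 'cV[R]_n => SURE sigma (sample_mx Y w) p.1 p.2)
  = [set (Theta_hat sigma (sample_mx Y w), beta_hat sigma (sample_mx Y w))].
Proof. exact: argmin_SURE. Qed.
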